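(* For every positive integer $m$, there is a compact, connected, ancient solution $(M_t)_{t\in(-\infty,0)}$ to the curve shortening flow in $\mathbb{R}^{2m}$ such that, for every $t<0$, $M_t$ does not lie in any $(2m-1)$-dimensional Euclidean subspace of $\mathbb{R}^{2m}$.
   Context: A family of immersed $n$-dimensional submanifolds $M_t\subset\mathbb{R}^N$ is a solution to the mean curvature flow if its position vector $x$ satisfies $\partial_t x=-\vec{H}$, where $\vec H$ is minus the trace of the second fundamental form; equivalently $\partial_t x=\Delta_{M_t}x$, where $\Delta_{M_t}$ is the Laplace–Beltrami operator of the metric induced on $M_t$, applied to each coordinate. The case $n=1$ is called the curve shortening flow. For a parametrized immersed curve $\gamma_t(\theta)$, $\Delta_{\gamma_t}=\frac{1}{|\partial_\theta\gamma_t|}\partial_\theta\big(\frac{1}{|\partial_\theta\gamma_t|}\partial_\theta\,\cdot\big)$. A solution is ancient if it is defined for all $t\in(-\infty,0)$. A Euclidean subspace means an affine subspace (not necessarily through the origin). Compact and connected mean that each $M_t$ is compact and connected. *)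

(* Defs.v *)
From HB Require Import structures.
From mathcomp Require Import all_boot all_order all_algebra.
From mathcomp Require Import all_classical all_reals all_analysis.

Set Implicit Arguments.
Unset Strict Implicit.
Unset Printing Implicit Defensive.

Import Order.TTheory GRing.Theory Num.Theory.
Import numFieldNormedType.Exports.

Local Open Scope classical_set_scope.
Local Open Scope ring_scope.

(* The library norm on row vectors is the sup norm, hence this definition. *)
Definition eucl_norm (R : realType) (N : nat) (v : 'rV[R]_N) : R :=
  Num.sqrt (\sum_(i < N) v 0 i ^+ 2).

(* C^k on an open set U, without choosing coordinates: for W of finite
   dimension it suffices to iterate directional derivatives.  As U is open,
   the values of f outside U are irrelevant. *)
Fixpoint Ck_on (R : realType) (W V : normedModType R) (k : nat)
    (U : set W) (f : W -> V) : Prop :=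
  match k with
  | 0%N => forall p, U p -> {for p, continuous f}
  | k'.+1 => (forall p, U p -> differentiable f p) /\
             (forall v : W, Ck_on k' U (fun p => 'D_v f p))
  end.

Definition smooth_on (R : realType) (W V : normedModType R)
    (U : set W) (f : W -> V) : Prop :=
  forall k, Ck_on k U f.

Section CurveShortening.
Variables (R : realType) (N : nat).

Definition arclength_derive (c : R -> 'rV[R]_N) (f : R -> R) : R -> R :=
  fun s => (eucl_norm (derive1 c s))^-1 * derive1 f s.

Definition laplace_beltrami (c : R -> 'rV[R]_N) (f : R -> R) : R -> R :=
  arclength_derive c (arclength_derive c f).

Implicit Types (I : set R) (gamma : R -> R -> 'rV[R]_N).

(* gamma t s is the position at time t of the point with parameter s; the set
   I of times is meant to be open. *)
Definition curve_shortening_flow I gamma : Prop :=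
  [/\ smooth_on (I `*` setT) (fun p : R * R => gamma p.1 p.2),
      (forall t s, I t -> derive1 (gamma t) s != 0) &
      (forall t s i, I t ->
         derive1 (fun t' => gamma t' s 0 i) t =
         laplace_beltrami (gamma t) (fun s' => gamma t s' 0 i) s)].

(* A compact connected curve (without boundary) is an immersion of the circle
   R / 2 pi Z, i.e. a 2 pi-periodic immersion of the line; M_t is the image.
   Compactness and connectedness of M_t follow, but are spelled out. *)
Definition compact_connected_flow I gamma : Prop :=
  forall t, I t ->
    [/\ forall s, gamma t (s + 2 * pi) = gamma t s,
        compact (range (gamma t)) &
        connected (range (gamma t))].

Definition ancient_times : set R := [set t | t < 0].

Definition affine_subspace (p : 'rV[R]_N) (W : {vspace 'rV[R]_N}) :
    set 'rV[R]_N :=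
  [set x | x - p \in W].

End CurveShortening.

(* Main.v *)
Require Import Defs.
From mathcomp Require Import all_boot all_order all_algebra.
From mathcomp Require Import all_classical all_reals all_analysis.
From mathcomp Require Import ring.
Import Order.TTheory GRing.Theory Num.Theory.
Import numFieldNormedType.Exports.
Local Open Scope classical_set_scope.
Local Open Scope ring_scope.

Set Implicit Arguments.
Unset Strict Implicit.

(** Identify R^2m with C^m and let the curve be
    gamma_t(s) = (rho e^(is), rho^4 e^(2is), ..., rho^(m^2) e^(mis)), rho = rho(t).
    Its speed depends on t only and the k-th coordinate is an eigenfunction of
    d^2/ds^2 with eigenvalue -k^2, so the flow reduces to the single equation
    rho' = - rho / (sum_k k^2 rho^(2k^2)).  It integrates to
    sum_k rho^(2k^2) = -2t, which defines rho > 0 for all t < 0.  The functions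
    1, cos(ks), sin(ks), 1 <= k <= m, being linearly independent, no affine
    hyperplane contains the curve. *)

(** * Smoothness from families of functions closed under derivation *)

Lemma near_eq_differentiable {R : numFieldType} {V W : normedModType R}
    (f g : V -> W) (x : V) :
  (\near x, f x = g x) -> differentiable f x -> differentiable g x.
Proof.
move=> fg df; have /diff_locallyP [cdf dfE] := df.
(* The first-order expansion of [f] is also one of [g], with the same linear part; uniqueness of the
   differential then identifies ['d g x] with ['d f x]. *)
have gE : g \o shift x = cst (g x) + 'd f x +o_ 0 id.
  apply/eqaddoP => e e0.
  have : f \o shift x = cst (f x) + 'd f x +o_ 0 id := dfE.
  move=> /eqaddoP/(_ e e0) H.
  have H2 : \forall y \near 0, f (y + x) = g (y + x).
    by have := fg; rewrite (near_shift 0 x)/=; apply: filterS => y /=; rewrite subr0.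
  apply: filterS2 H H2 => y.
  by rewrite /= !fctE /= (nbhs_singleton fg) => + <-.
have dgE := diff_unique cdf gE.
by apply/diff_locallyP; rewrite dgE.
Unshelve. all: by end_near. Qed.

(** Openness of [U] turns agreement on [U] into agreement near each of its points, which derivatives
    inherit, so the induction on [k] goes through. *)
Lemma eq_Ck_on {R : realType} {W V : normedModType R} (k : nat) (U : set W)
    (f g : W -> V) :
  open U -> {in U, f =1 g} -> Ck_on k U f -> Ck_on k U g.
Proof.
move=> oU; elim: k f g => [|k IH] f g fg /=.
  move=> cf p Up.
  have nfg : \near p, f p = g p.
    by near=> q; apply: fg; rewrite inE; near: q; exact: open_nbhs_nbhs.
  rewrite /prop_for/= /continuous_at -(nbhs_singleton nfg).
  apply: cvg_trans (cf p Up); exact: near_eq_cvg.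
have nfg p : U p -> \near p, f p = g p.
  by move=> Up; near=> q; apply: fg; rewrite inE; near: q; exact: open_nbhs_nbhs.
move=> [df Df]; split=> [p Up|v].
  by apply: near_eq_differentiable (df p Up); exact: nfg.
by apply: IH (Df v) => p /set_mem Up; apply: near_eq_derive; exact: nfg.
Unshelve. all: by end_near. Qed.

(** Reduces smoothness to a first-order check: the derivative of a member is again a member up to
    equality on [U], so induction on [k] covers all orders. *)
Lemma closed_family_smooth_on {R : realType} {W V : normedModType R} (U : set W)
    (A : set (W -> V)) :
  open U ->
  (forall f p, A f -> U p -> differentiable f p) ->
  (forall f v, A f -> exists2 g, A g & {in U, (fun p => 'D_v f p) =1 g}) ->
  forall f, A f -> smooth_on U f.
Proof.
move=> oU dA DA f Af k; elim: k f Af => [|k IH] f Af /=.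
  by move=> p Up; apply: differentiable_continuous; exact: dA.
split=> [p Up|v]; first exact: dA.
have [g Ag Dfg] := DA _ v Af.
by apply: eq_Ck_on (IH g Ag) => // p Up; rewrite Dfg.
Qed.

Section GeneratedAlgebra.
Context {R : realType} {W : normedModType R}.
Variables (U : set W) (G : set (W -> R)).

Inductive gen_alg : (W -> R) -> Prop :=
| gen_alg_gen g : G g -> gen_alg g
| gen_alg_cst c : gen_alg (fun=> c)
| gen_algD f g : gen_alg f -> gen_alg g -> gen_alg (fun p => f p + g p)
| gen_algM f g : gen_alg f -> gen_alg g -> gen_alg (fun p => f p * g p).

Lemma gen_alg_sum n (F : 'I_n -> W -> R) :
  (forall i, gen_alg (F i)) -> gen_alg (fun p => \sum_(i < n) F i p).
Proof.
elim: n F => [|n IH] F FG.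
  by under eq_fun do rewrite big_ord0; exact: gen_alg_cst.
under eq_fun do rewrite big_ord_recr/=.
by apply: gen_algD => //; exact: IH.
Qed.

Lemma gen_algX n f : gen_alg f -> gen_alg (fun p => f p ^+ n).
Proof.
move=> fG; elim: n => [|n IH]; first by under eq_fun do rewrite expr0; exact: gen_alg_cst.
by under eq_fun do rewrite exprS; exact: gen_algM.
Qed.

Hypothesis openU : open U.
Hypothesis diffG : forall g p, G g -> U p -> differentiable g p.
Hypothesis derG : forall g v, G g ->
  exists2 h, gen_alg h & {in U, (fun p => 'D_v g p) =1 h}.

Lemma gen_alg_differentiable f p : gen_alg f -> U p -> differentiable f p.
Proof.
move=> + Up; elim=> [g Gg|c|{}f g _ df _ dg|{}f g _ df _ dg].
- exact: diffG.
- exact: differentiable_cst.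
- exact: differentiableD.
- exact: differentiableM.
Qed.

(** By the Leibniz rule, closure of the algebra under derivation has to be checked on the generators
    only. *)
Lemma gen_alg_derive f v : gen_alg f ->
  exists2 h, gen_alg h & {in U, (fun p => 'D_v f p) =1 h}.
Proof.
elim=> [g Gg|c|{}f g fG [f' f'G Df] gG [g' g'G Dg]|{}f g fG [f' f'G Df] gG [g' g'G Dg]].
- exact: derG.
- by exists (fun=> 0); [exact: gen_alg_cst|move=> p _; rewrite derive_cst].
- exists (fun p => f' p + g' p); first exact: gen_algD.
  move=> p Up; rewrite -Df// -Dg// deriveD//;
    by apply: diff_derivable; apply: gen_alg_differentiable; rewrite ?inE// -inE.
- exists (fun p => f p * g' p + g p * f' p).
    by apply: gen_algD; exact: gen_algM.
  move=> p Up; rewrite -Df// -Dg// deriveM//;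
    by apply: diff_derivable; apply: gen_alg_differentiable; rewrite ?inE// -inE.
Qed.

Lemma gen_alg_row_smooth n (F : 'I_n -> W -> R) :
  (forall i, gen_alg (F i)) -> smooth_on U (fun p => \row_i F i p).
Proof.
move=> FG.
pose A : set (W -> 'rV[R]_n) :=
  [set f | exists2 F : 'I_n -> W -> R, (forall i, gen_alg (F i)) &
           f = fun p => \row_i F i p].
have dA f p : A f -> U p -> differentiable f p.
  move=> [{}F {}FG ->] Up.
  (* Expanding along the standard basis makes the row a sum of scalar functions times constant
     vectors. *)
  have -> : (fun p => \row_i F i p) =
      \sum_(i < n) (fun p => F i p *: (delta_mx 0 i : 'rV[R]_n)).
    apply/funext => q; rewrite fct_sumE; apply/rowP => j.
    rewrite mxE summxE (bigD1 j)//= big1 => [|i ij].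
      by rewrite !mxE !eqxx mulr1 addr0.
    by rewrite !mxE eqxx (negbTE (_ : j != i)) ?mulr0// eq_sym.
  apply: differentiable_sum => i; apply: differentiableZl.
  exact: gen_alg_differentiable.
apply: (@closed_family_smooth_on _ _ _ U A openU) => //; last by exists F.
move=> f v [{}F {}FG fE].
have /choice[H HP] : forall i, exists h,
    gen_alg h /\ {in U, (fun p => 'D_v (F i) p) =1 h}.
  by move=> i; have [h hG Dh] := gen_alg_derive v (FG i); exists h.
exists (fun p => \row_i H i p); first by exists H => // i; exact: (HP i).1.
move=> p Up; rewrite derive_mx; last first.
  by apply: diff_derivable; apply: dA; [exists F|exact/set_mem].
apply/rowP => i; rewrite !mxE -(HP i).2//; congr ('D_v _ p).
by apply/funext => q; rewrite fE mxE.
Qed.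

End GeneratedAlgebra.

(** * The radius function and its differential equation *)

Section Radius.
Context {R : realType}.
Variable (m : nat).
Hypothesis m_gt0 : (0 < m)%N.

(** For rho = [x], [sqradius] is the squared distance from the curve to the origin and [sqspeed] the
    squared length of its velocity in s. *)
Definition sqradius (x : R) : R := \sum_(k < m) x ^+ (2 * k.+1 ^ 2).
Definition sqspeed (x : R) : R := \sum_(k < m) k.+1%:R ^+ 2 * x ^+ (2 * k.+1 ^ 2).

(** Here [df] is the logarithmic derivative of [f]: differentiating a power then keeps its exponent
    n and only multiplies it by n [df]. *)
Lemma is_derive_powsum (c : nat -> R) (f : R -> R) (t df : R) :
  is_derive t 1 f (f t * df) ->
  is_derive t 1 (fun t => \sum_(k < m) c k * f t ^+ (2 * k.+1 ^ 2))
    (2 * (\sum_(k < m) c k * k.+1%:R ^+ 2 * f t ^+ (2 * k.+1 ^ 2)) * df).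
Proof.
move=> Df.
have -> : (fun t => \sum_(k < m) c k * f t ^+ (2 * k.+1 ^ 2)) =
  \sum_(k < m) (fun t => c k * f t ^+ (2 * k.+1 ^ 2)).
  by apply/funext => x; rewrite fct_sumE.
rewrite mulr_sumr mulr_suml; apply: is_derive_sum => k.
have -> : (fun t => c k * f t ^+ (2 * k.+1 ^ 2)) =
  c k *: (f ^+ (2 * k.+1 ^ 2)) by apply/funext => x; rewrite fctE.
apply: is_derive_eq.
rewrite /GRing.scale/= natrM natrX.
have -> : f t ^+ (2 * k.+1 ^ 2) = f t * f t ^+ (2 * k.+1 ^ 2).-1.
  by rewrite -exprS prednK// muln_gt0 expn_gt0.
ring.
Qed.

Lemma sqspeed_gt0 x : 0 < x -> 0 < sqspeed x.
Proof.
move=> x0; rewrite /sqspeed; case: m m_gt0 => // n _.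
rewrite big_ord_recl ltr_wpDr ?sumr_ge0//.
  by move=> i _; rewrite mulr_ge0 ?exprn_ge0 ?ler0n// ltW.
by rewrite mulr_gt0 ?exprn_gt0 ?ltr0n.
Qed.

Lemma is_derive_sqradius (x : R) : x != 0 ->
  is_derive x 1 sqradius (2 * sqspeed x / x).
Proof.
move=> x0.
have Di : is_derive x (1:R) (id : R -> R) (x * x^-1).
  by rewrite mulfV //; exact: is_derive_id.
have := @is_derive_powsum (fun=> 1) id x x^-1 Di.
under eq_fun do under eq_bigr do rewrite mul1r.
by under eq_bigr do rewrite mul1r.
Qed.

Lemma sqradius_inj x y : 0 < x -> 0 < y -> sqradius x = sqradius y -> x = y.
Proof.
move=> x0 y0.
wlog xy : x y x0 y0 / x < y.
  move=> H; case: (ltgtP x y) => // xy E; first exact: H.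
  by apply/esym; apply: H.
move=> E; suff : sqradius x < sqradius y by rewrite E ltxx.
rewrite /sqradius; case: m m_gt0 => // n _.
rewrite !big_ord_recl ltr_leD//.
  by rewrite ltr_pXn2r ?nnegrE ?ltW.
by apply: ler_sum => i _; rewrite lerXn2r ?nnegrE ?ltW.
Qed.

Lemma sqradius_surj y : 0 < y -> exists2 x, 0 < x & sqradius x = y.
Proof.
move=> y0.
have sq0 : sqradius 0 = 0.
  by rewrite /sqradius big1// => i _; rewrite expr0n muln_eq0 expn_eq0.
have cq : continuous sqradius.
  move=> x.
  have -> : sqradius = (\sum_(k < m) (fun x => x ^+ (2 * k.+1 ^ 2))).
    by apply/funext => z; rewrite fct_sumE.
  elim/big_ind : _ => [|f g cf cg|i _]; first exact: cst_continuous.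
    exact: continuousD.
  exact: exprn_continuous.
(* Since 1 + y is at least 1, its square, which is the first term of the sum, is already at least 1
   + y. *)
have big : y <= sqradius (1 + y).
  rewrite /sqradius; case: m m_gt0 => // n _.
  rewrite big_ord_recl ler_wpDr ?sumr_ge0//.
    by move=> i _; rewrite exprn_ge0// addr_ge0// ltW.
  rewrite /= muln1 (@le_trans _ _ (1 + y))// ?lerDr// ler_eXnr// lerDl ltW//.
have [||| x] := @IVT R sqradius 0 (1 + y) y.
- by rewrite addr_ge0// ltW.
- exact: continuous_subspaceT.
- rewrite sq0 ge_min le_max (ltW y0) big orbT//.
- move=> /itvP xb xE; exists x => //.
  rewrite lt_neqAle xb andbT eq_sym; apply/eqP => x0.
  by move: y0; rewrite -xE x0 sq0 ltxx.
Qed.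

(* The value at t >= 0 is irrelevant. *)
Definition radius (t : R) : R := xget 0 [set x | 0 < x /\ sqradius x = - (2 * t)].

Lemma radiusP t : t < 0 -> 0 < radius t /\ sqradius (radius t) = - (2 * t).
Proof.
move=> t0; have [|x x0 xE] := @sqradius_surj (- (2 * t)) _.
  by rewrite oppr_gt0 pmulr_rlt0.
by rewrite /radius; case: xgetP => [_ -> []//|/(_ x)]; case.
Qed.

(** Inverse function rule: [radius] inverts x |-> - [sqradius] x / 2 on positive reals. The
    derivative is written as [radius t] times a logarithmic derivative, as [is_derive_powsum]
    expects. *)
Lemma is_derive_radius (t : R) : t < 0 ->
  is_derive t 1 radius (radius t * - (sqspeed (radius t))^-1).
Proof.
move=> t0; have [r0 rE] := radiusP t0.
pose f x : R := - 2^-1 * sqradius x.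
have fr : f (radius t) = t by rewrite /f rE; field.
have Df (x : R) : 0 < x -> is_derive x 1 f (- (sqspeed x / x)).
  move=> x0; have := is_derive_sqradius (lt0r_neq0 x0) => D.
  have -> : f = - 2^-1 *: sqradius by apply/funext.
  by apply: is_derive_eq; rewrite /GRing.scale/=; field; rewrite lt0r_neq0.
have n0 : \forall x \near radius t, 0 < x by apply: open_nbhs_nbhs; split => //; exact: open_gt.
rewrite -[in is_derive t](fr).
have -> : radius t * - (sqspeed (radius t))^-1 = (- (sqspeed (radius t) / radius t))^-1.
  by field; rewrite !lt0r_neq0// sqspeed_gt0.
apply: is_derive_inverse.
(* For x > 0 the time [f x] is negative, so [radiusP] applies there, and injectivity of [sqradius]
   gives [radius (f x) = x]. *)
- near=> x; have x0 : 0 < x by near: x.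
  have fx0 : f x < 0.
    rewrite /f mulNr oppr_lt0 mulr_gt0// /sqradius.
    case: m m_gt0 => // n _; rewrite big_ord_recl ltr_wpDr ?exprn_gt0//.
    by rewrite sumr_ge0// => i _; rewrite exprn_ge0// ltW.
  have [r1 r1E] := radiusP fx0.
  by apply: sqradius_inj => //; rewrite r1E /f; field.
- near=> x; have x0 : 0 < x by near: x.
  have [+ _] := Df x x0 => /derivable1_diffP; exact: differentiable_continuous.
- exact: Df.
- by rewrite oppr_eq0 mulf_neq0 ?invr_eq0 ?lt0r_neq0// sqspeed_gt0.
Unshelve. all: by end_near. Qed.

(** The derivative is a polynomial in [radius] and in the reciprocal itself, so no new function
    appears. Two of the three reciprocal factors come from differentiating an inverse, the third
    from the equation of [radius]. *)
Lemma is_derive_invspeed (t : R) : t < 0 ->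
  is_derive t 1 (fun t => (sqspeed (radius t))^-1)
    (2 * (\sum_(k < m) k.+1%:R ^+ 4 * radius t ^+ (2 * k.+1 ^ 2))
      * (sqspeed (radius t))^-1 ^+ 3).
Proof.
move=> t0; have [r0 rE] := radiusP t0.
have D := @is_derive_powsum (fun k => k.+1%:R ^+ 2) _ _ _ (is_derive_radius t0).
have s0 : sqspeed (radius t) != 0 by rewrite lt0r_neq0// sqspeed_gt0.
have DV := @is_deriveV _ (fun t => sqspeed (radius t)) _ _ _ s0 D.
apply: is_derive_eq.
under eq_bigr do rewrite -exprD.
by rewrite /GRing.scale/=; field.
Qed.
End Radius.

(** * Linear independence of 1, cos(ks) and sin(ks) *)

Section TrigIndep.
Variable R : realType.

Lemma cosDB (x h : R) : cos (x + h) + cos (x - h) = 2 * cos h * cos x.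
Proof. rewrite cosD cosB; ring. Qed.
Lemma sinDB (x h : R) : sin (x + h) + sin (x - h) = 2 * cos h * sin x.
Proof. rewrite sinD sinB; ring. Qed.

(** Linear independence with coefficients taken modulo [W], where [p] is the coefficient of the
    constant function 1. The induction removes the top frequency and rescales the other
    coefficients, hence the generality in [a], [b] and [p]. *)
Lemma trig_span_sub (V : vectType R) (W : {vspace V}) (n : nat)
    (a b : nat -> V) (p : V) :
  (forall s : R, \sum_(k < n) (cos (k.+1%:R * s) *: a k + sin (k.+1%:R * s) *: b k)
      - p \in W) ->
  forall k, (k < n)%N -> (a k \in W) && (b k \in W).
Proof.
elim: n a b p => [//|n IH] a b p H.
(* The operator f |-> f(s + h) + f(s - h) + 2 f(s) multiplies the terms of
   frequency j by 2 cos(jh) + 2, which vanishes only for the top frequency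
   n.+1 when h = pi / n.+1. *)
pose h : R := pi / n.+1%:R.
have nh : n.+1%:R * h = pi by rewrite /h mulrC divfK// pnatr_eq0.
pose c k : R := 2 * cos (k.+1%:R * h) + 2.
have low k : (k < n)%N -> (a k \in W) && (b k \in W).
  move=> kn.
  have ck0 : c k != 0.
    rewrite /c; have -> : 2 * cos (k.+1%:R * h) + 2 = 2 * (cos (k.+1%:R * h) - - 1) by ring.
    rewrite mulf_neq0 ?pnatr_eq0// subr_eq0 -cospi.
    apply/eqP => /cos_inj.
    have kh : 0 <= k.+1%:R * h <= pi.
      rewrite -nh mulr_ge0 ?ler0n ?divr_ge0 ?ler0n ?pi_ge0//=.
      by rewrite ler_pM2r ?ler_nat ?divr_gt0 ?pi_gt0 ?ltr0n// ltnW.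
    rewrite !in_itv /= kh lexx pi_ge0 => /(_ isT isT) /eqP.
    rewrite -nh (inj_eq (mulIf _)) ?eqr_nat; last by rewrite gt_eqF// divr_gt0 ?pi_gt0 ?ltr0n.
    by rewrite eqSS ltn_eqF.
  (* On constants the operator acts as 1 + 1 + 2 = 4. *)
  have := IH (fun k => c k *: a k) (fun k => c k *: b k) (4 *: p) _ k kn.
  rewrite !rpredZeq (negbTE ck0) /=; apply => s.
  have -> : \sum_(k0 < n) (cos (k0.+1%:R * s) *: (c k0 *: a k0) +
       sin (k0.+1%:R * s) *: (c k0 *: b k0)) - 4 *: p =
    (\sum_(k < n.+1) (cos (k.+1%:R * (s + h)) *: a k + sin (k.+1%:R * (s + h)) *: b k) - p)
   + (\sum_(k < n.+1) (cos (k.+1%:R * (s - h)) *: a k + sin (k.+1%:R * (s - h)) *: b k) - p)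
   + 2 *: (\sum_(k < n.+1) (cos (k.+1%:R * s) *: a k + sin (k.+1%:R * s) *: b k) - p).
    have E k0 : cos (k0.+1%:R * s) *: (c k0 *: a k0) +
       sin (k0.+1%:R * s) *: (c k0 *: b k0) =
      (cos (k0.+1%:R * (s + h)) *: a k0 + sin (k0.+1%:R * (s + h)) *: b k0)
   + (cos (k0.+1%:R * (s - h)) *: a k0 + sin (k0.+1%:R * (s - h)) *: b k0)
   + 2 *: (cos (k0.+1%:R * s) *: a k0 + sin (k0.+1%:R * s) *: b k0).
      rewrite mulrDr mulrBr addrACA -!scalerDl cosDB sinDB scalerDr !scalerA.
      rewrite addrACA -!scalerDl /c.
      by congr (_ *: _ + _ *: _); exact: mulrC.
    (* The top frequency can be added back for free, as its factor [c n] is zero. *)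
    transitivity (\sum_(k0 < n.+1) (cos (k0.+1%:R * s) *: (c k0 *: a k0) +
       sin (k0.+1%:R * s) *: (c k0 *: b k0)) - 4 *: p).
      rewrite big_ord_recr/= /c nh cospi.
      by rewrite (_ : 2 * -1 + 2 = 0 :> R) ?scale0r ?scaler0 ?addr0//; ring.
    under eq_bigr do rewrite E.
    rewrite !big_split/= -scaler_sumr scalerBr.
    rewrite [X in _ = X + _]addrACA [RHS]addrACA; congr (_ + _).
      by rewrite big_split.
    by rewrite -!scalerN -[- p in X in _ = X + _]scale1r -!scalerDl; congr (_ *: _); ring.
  by apply: rpredD; [apply: rpredD|apply: rpredZ]; exact: H.
move=> k; rewrite ltnS leq_eqVlt => /predU1P[->|]; last exact: low.
have top s : cos (n.+1%:R * s) *: a n + sin (n.+1%:R * s) *: b n - p \in W.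
  have := H s; rewrite big_ord_recr/= -addrA rpredDl//.
  by apply: rpred_sum => i _; have /andP[? ?] := low i (ltn_ord i);
    rewrite rpredD ?rpredZ.
(* The points s = h and s = 0 give - [a n] - p and [a n] - p in [W]; their sum puts p, and then
   [a n], in [W]. The quarter period s = h / 2 isolates [b n]. *)
have := top h; rewrite nh cospi sinpi scale0r addr0 scaleN1r => H1.
have := top 0; rewrite mulr0 cos0 sin0 scale0r addr0 scale1r => H0.
have := rpredD H0 H1; rewrite addrACA subrr add0r -opprD rpredN.
rewrite -[p]scale1r -scalerDl rpredZeq => /orP[|pW].
  by rewrite paddr_eq0 ?ler01// oner_eq0.
move: H0; rewrite rpredBr// => -> /=.
have := top (h / 2); rewrite mulrA nh cos_pihalf sin_pihalf scale0r add0r scale1r.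
by rewrite rpredBr.
Qed.
End TrigIndep.

(** * Auxiliary facts on composition, periodicity and paired sums *)

Lemma derive_comp_linear {R : realType} {V : normedModType R}
    (p : {linear V -> R}) (f : R -> R) (x v : V) (df : R) :
  continuous p -> is_derive (p x) 1 f df ->
  differentiable (f \o p) x /\ 'D_v (f \o p) x = p v * df.
Proof.
move=> cp [fx fdf]; have df' : differentiable f (p x) by exact/derivable1_diffP.
have dp : differentiable p x by apply: linear_differentiable; exact: cp.
split; first exact: differentiable_comp.
rewrite deriveE; last exact: differentiable_comp.
rewrite diff_comp// /comp/= diff_lin// -[p v in LHS]mulr1 -[_ * 1]/(_ *: 1) linearZ/=.
by rewrite -deriveE// fdf.
Qed.

(** Makes the trace of a closed curve the image of a segment, from which compactness and
    connectedness follow. *)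
Lemma periodic_range {R : realType} {T : Type} (f : R -> T) (P : R) :
  0 < P -> (forall s, f (s + P) = f s) -> range f = f @` `[0, P].
Proof.
move=> P0 fP; apply/seteqP; split=> [_ [s _ <-]|_ [s _ <-]]; last by exists s.
have fPn n s' : f (s' + P *+ n) = f s'.
  by elim: n s' => [|n IH] s'; rewrite ?addr0// mulrSr addrA fP.
pose z := Num.floor (s / P); pose x := s - z%:~R * P.
have /andP[zl zu] := floor_itv (s / P).
exists x.
  rewrite /= in_itv/= /x subr_ge0 lerBlDr -ler_pdivlMr// zl/=.
  by rewrite -[X in X + _]mul1r -mulrDl -ler_pdivrMr// addrC -(intrD _ z 1) ltW.
(* [fPn] covers natural multiples of the period only, so the sign of the floor is distinguished. *)
rewrite /x; case: z {x zl zu} => n.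
  by rewrite -(fPn n) pmulrn mulr_natl subrK.
by rewrite NegzE mulrNz mulNr opprK -pmulrn mulr_natl fPn.
Qed.

Lemma sum_double {V : nmodType} (F : nat -> V) (m : nat) :
  \sum_(i < 2 * m) F i = \sum_(k < m) (F k.*2 + F k.*2.+1).
Proof.
elim: m => [|m IH]; first by rewrite muln0 !big_ord0.
by rewrite mulnS !big_ord_recr/= IH mul2n addrA.
Qed.

(** * The curve: flow equation, smoothness and affine span *)

Section Curve.
Context {R : realType}.

(* Coordinates 2k and 2k+1 are the real and imaginary parts of the complex
   coordinate of frequency k+1. *)
Definition trig (j : nat) (s : R) : R :=
  let k := j./2.+1%:R in if odd j then sin (k * s) else cos (k * s).
Definition dtrig (j : nat) (s : R) : R :=
  let k := j./2.+1%:R in if odd j then k * cos (k * s) else - (k * sin (k * s)).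

Lemma is_derive_scal_arg (f : R -> R) (k s df : R) :
  is_derive (k * s) 1 f df -> is_derive s 1 (fun s => f (k * s)) (k * df).
Proof.
move=> Df; have Dk : is_derive s 1 (k *: (id : R -> R)) k.
  by apply: is_derive_eq; rewrite /GRing.scale/= mulr1.
by rewrite mulrC; exact: (@is_derive1_comp _ f (k *: (id : R -> R))).
Qed.

Lemma is_derive_trig j (s : R) : is_derive s 1 (trig j) (dtrig j s).
Proof.
rewrite /trig /dtrig; case: odd; first exact: is_derive_scal_arg.
by rewrite -mulrN; exact: is_derive_scal_arg.
Qed.

Lemma is_derive_dtrig j (s : R) :
  is_derive s 1 (dtrig j) (- (j./2.+1%:R ^+ 2 * trig j s)).
Proof.
rewrite /trig /dtrig; set k := j./2.+1%:R; case: odd.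
  have D := is_derive_scal_arg (f := cos) (k := k) (s := s) (is_derive_cos _).
  rewrite -[X in is_derive _ _ X]/(k *: (fun s => cos (k * s))).
  by apply: is_derive_eq; rewrite /GRing.scale/=; ring.
have D := is_derive_scal_arg (f := sin) (k := k) (s := s) (is_derive_sin _).
rewrite -[X in is_derive _ _ X]/(- (k *: (fun s => sin (k * s)))).
by apply: is_derive_eq; rewrite /GRing.scale/=; ring.
Qed.

Lemma trig_periodic j (s : R) : trig j (s + 2 * pi) = trig j s.
Proof.
have E (k : nat) : k%:R * (s + 2 * pi) = k%:R * s + pi *+ 2 *+ k.
  by rewrite mulrDr [2 * pi]mulr_natl [_ * (_ *+ 2)]mulr_natl.
rewrite /trig; case: odd; rewrite E periodicn//.
  exact: sinD2pi.
exact: cosD2pi.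
Qed.

Variable m : nat.
Hypothesis m_gt0 : (0 < m)%N.

Definition curve (t s : R) : 'rV[R]_(2 * m) :=
  \row_i (radius m t ^+ (i./2.+1 ^ 2) * trig i s).

Lemma is_derive_row n (F dF : 'I_n -> R -> R) (s : R) :
  (forall i, is_derive s 1 (F i) (dF i s)) ->
  is_derive s 1 (fun s => \row_i F i s : 'rV[R]_n) (\row_i dF i s).
Proof.
move=> DF; have dF' : derivable (fun s => \row_i F i s : 'rV[R]_n) s 1.
  apply/derivable_mxP => i j; under eq_fun do rewrite mxE.
  by have [] := DF j.
split => //; rewrite derive_mx//; apply/rowP => j; rewrite !mxE.
by under eq_fun do rewrite mxE; have [_] := DF j.
Qed.

Lemma is_derive_curve (t s : R) :
  is_derive s 1 (curve t) (\row_i (radius m t ^+ (i./2.+1 ^ 2) * dtrig i s)).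
Proof.
apply: (is_derive_row (dF := fun i s => radius m t ^+ (i./2.+1 ^ 2) * dtrig i s)) => i.
have D := is_derive_trig i s.
rewrite -[X in is_derive _ _ X]/(radius m t ^+ (i./2.+1 ^ 2) *: trig i).
exact: is_derive_eq.
Qed.

Lemma derive1_curve (t s : R) :
  derive1 (curve t) s = \row_i (radius m t ^+ (i./2.+1 ^ 2) * dtrig i s).
Proof. by rewrite derive1E; have [_] := is_derive_curve t s. Qed.

(** In each complex coordinate the squares of sine and cosine add up to 1, so the speed does not
    depend on [s]. *)
Lemma speed_curve (t s : R) :
  eucl_norm (derive1 (curve t) s) = Num.sqrt (sqspeed m (radius m t)).
Proof.
rewrite derive1_curve /eucl_norm; congr Num.sqrt.
under eq_bigr do rewrite mxE.
rewrite (sum_double (fun j => (radius m t ^+ (j./2.+1 ^ 2) * dtrig j s) ^+ 2)).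
apply: eq_bigr => k _; rewrite /dtrig /= odd_double uphalf_double doubleK /=.
rewrite mulrN sqrrN !exprMn -exprM mulnC -!mulrDr.
by rewrite [sin _ ^+ _ + _]addrC cos2Dsin2 mulr1 mulrC.
Qed.

Lemma curve_immersed (t s : R) : t < 0 -> derive1 (curve t) s != 0.
Proof.
move=> t0; apply/eqP => c0; have := speed_curve t s.
rewrite c0 /eucl_norm big1 ?sqrtr0 => [|i _]; last by rewrite mxE expr0n.
have [r0 _] := radiusP m_gt0 t0.
by apply/eqP; rewrite eq_sym gt_eqF// sqrtr_gt0 sqspeed_gt0.
Qed.

(** With speed L constant in [s], the operator is the second derivative in [s] divided by L^2, and
    each coordinate is an eigenfunction of it. *)
Lemma laplace_beltrami_curve (t s : R) (i : 'I_(2 * m)) : t < 0 ->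
  laplace_beltrami (curve t) (fun s' => curve t s' 0 i) s =
  - (i./2.+1%:R ^+ 2 / sqspeed m (radius m t) * curve t s 0 i).
Proof.
move=> t0; have [r0 _] := radiusP m_gt0 t0.
have S0 := sqspeed_gt0 m_gt0 r0.
rewrite /laplace_beltrami /arclength_derive speed_curve.
set r := radius m t ^+ (i./2.+1 ^ 2); set L := Num.sqrt _.
have -> : (fun s0 => (eucl_norm (derive1 (curve t) s0))^-1 *
    derive1 (fun s' => curve t s' 0 i) s0) = (L^-1 * r) *: dtrig i.
  apply/funext => s'; rewrite speed_curve -/L derive1E.
  have -> : (fun s' => curve t s' 0 i) = r *: trig i.
    by apply/funext => x; rewrite mxE.
  have D := is_derive_trig i s'.
  by rewrite derive_val /GRing.scale/= mulrA.
have D := is_derive_dtrig i s.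
rewrite derive1E derive_val mxE -/r /GRing.scale/=.
have -> : sqspeed m (radius m t) = L ^+ 2 by rewrite sqr_sqrtr// ltW.
by field; rewrite gt_eqF// sqrtr_gt0.
Qed.

(** This is where the exponents k^2 matter: the logarithmic derivative of rho^(k^2) is k^2 rho'/rho,
    which matches the eigenvalue for every frequency k at once. *)
Lemma derive1_time_curve (t s : R) (i : 'I_(2 * m)) : t < 0 ->
  derive1 (fun t' => curve t' s 0 i) t =
  - (i./2.+1%:R ^+ 2 / sqspeed m (radius m t) * curve t s 0 i).
Proof.
move=> t0; have Dr := is_derive_radius m_gt0 t0.
have -> : (fun t' => curve t' s 0 i) = trig i s *: (radius m ^+ (i./2.+1 ^ 2)).
  by apply/funext => x; rewrite mxE mulrC fctE.
rewrite derive1E derive_val mxE /GRing.scale/= natrX.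
have -> : radius m t ^+ (i./2.+1 ^ 2) = radius m t * radius m t ^+ (i./2.+1 ^ 2).-1.
  by rewrite -exprS prednK// expn_gt0.
ring.
Qed.

(** Every coordinate lies in the algebra generated by [radius], the reciprocal of [sqspeed] along
    it, and the functions cos(ks), sin(ks). The reciprocal is a generator because the derivative of
    [radius] involves it and the algebra has no division. *)
Lemma curve_smooth :
  smooth_on (@ancient_times R `*` setT) (fun p : R * R => curve p.1 p.2).
Proof.
pose G : set (R * R -> R) := [set g |
  [\/ g = radius m \o fst, g = (fun t => (sqspeed m (radius m t))^-1) \o fst |
      exists k, g = (fun s => cos (k * s)) \o snd \/ g = (fun s => sin (k * s)) \o snd]].
have cfst : continuous (fst : R * R -> R) by move=> p; exact: cvg_fst.
have csnd : continuous (snd : R * R -> R) by move=> p; exact: cvg_snd.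
have Gr : gen_alg G (fun p => radius m p.1) by apply: gen_alg_gen; constructor 1.
have Gw : gen_alg G (fun p => (sqspeed m (radius m p.1))^-1).
  by apply: gen_alg_gen; constructor 2.
have Gc k : gen_alg G (fun p => cos (k * p.2)).
  by apply: gen_alg_gen; constructor 3; exists k; left.
have Gs k : gen_alg G (fun p => sin (k * p.2)).
  by apply: gen_alg_gen; constructor 3; exists k; right.
have key g v : G g -> exists2 h, gen_alg G h &
    forall p, (@ancient_times R `*` setT) p -> differentiable g p /\ 'D_v g p = h p.
  move=> [->|->|[k [->|->]]].
  (* The opposite is written as a product with -1, since [gen_alg] is built from constants, sums and
     products. *)
  - exists (fun p => v.1 * (radius m p.1 * (-1 * (sqspeed m (radius m p.1))^-1))).
      by do !apply: gen_algM => //; exact: gen_alg_cst.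
    move=> p [/= p0 _]; rewrite mulN1r.
    exact: (derive_comp_linear (p := fst) v cfst (is_derive_radius m_gt0 p0)).
  - exists (fun p => v.1 * (2 * (\sum_(k < m) k.+1%:R ^+ 4 * radius m p.1 ^+ (2 * k.+1 ^ 2))
      * (sqspeed m (radius m p.1))^-1 ^+ 3)).
      apply: gen_algM; first exact: gen_alg_cst.
      apply: gen_algM; last exact: gen_algX.
      apply: gen_algM; first exact: gen_alg_cst.
      apply: gen_alg_sum => k.
      by apply: gen_algM; [exact: gen_alg_cst|exact: gen_algX].
    move=> p [/= p0 _].
    exact: (derive_comp_linear (p := fst) v cfst (is_derive_invspeed m_gt0 p0)).
  - exists (fun p => v.2 * (k * (-1 * sin (k * p.2)))).
      by do !apply: gen_algM => //; exact: gen_alg_cst.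
    move=> p _; rewrite mulN1r.
    exact: (derive_comp_linear (p := snd) v csnd (is_derive_scal_arg (is_derive_cos _))).
  - exists (fun p => v.2 * (k * cos (k * p.2))).
      by do !apply: gen_algM => //; exact: gen_alg_cst.
    move=> p _.
    exact: (derive_comp_linear (p := snd) v csnd (is_derive_scal_arg (is_derive_sin _))).
have oU : open (@ancient_times R `*` [set: R]).
  rewrite (_ : _ `*` _ = fst @^-1` [set t : R | t < 0]).
    by apply: open_comp; [move=> p _; exact: cfst|exact: open_lt].
  by apply/seteqP; split => p /=; [case|].
apply: (gen_alg_row_smooth (G := G)) => //.
(* Differentiability does not depend on the direction, so 0 serves as well as any. *)
- by move=> g p Gg Up; have [h _ /(_ p Up)[]] := key g 0 Gg.
- move=> g v Gg; have [h Gh H] := key g v Gg.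
  by exists h => // p /set_mem Up; have [] := H p Up.
- move=> i; apply: gen_algM; first exact: gen_algX.
  by rewrite /trig; case: odd.
Qed.

(** The trigonometric coefficients of the curve are nonzero multiples of the standard basis vectors,
    and [trig_span_sub] forces all of them into [W]. *)
Lemma curve_spans (t : R) (p : 'rV[R]_(2 * m)) (W : {vspace 'rV[R]_(2 * m)}) :
  t < 0 -> range (curve t) `<=` affine_subspace p W -> W = fullv.
Proof.
move=> t0 tW; have [r0 _] := radiusP m_gt0 t0.
(* The index is a natural number, as [trig_span_sub] requires; for j at least 2m the vector is
   zero. *)
pose e j : 'rV[R]_(2 * m) := radius m t ^+ (j./2.+1 ^ 2) *: \row_i (i == j :> nat)%:R.
have curveE s : curve t s = \sum_(k < m)
    (cos (k.+1%:R * s) *: e k.*2 + sin (k.+1%:R * s) *: e k.*2.+1).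
  transitivity (\sum_(i < 2 * m) trig i s *: e i).
    apply/rowP => j; rewrite summxE (bigD1 j)//= big1 => [|i ij].
      by rewrite !mxE eqxx mulr1 addr0 mulrC.
    by rewrite !mxE (negbTE (_ : j != i :> nat)) ?mulr0// eq_sym.
  rewrite (sum_double (fun j => trig j s *: e j)); apply: eq_bigr => k _.
  by rewrite /trig /= odd_double uphalf_double doubleK.
have eW (j : 'I_(2 * m)) : e j \in W.
  have jm : (j./2 < m)%N by rewrite ltn_half_double -mul2n.
  have /andP[] : (e (j./2).*2 \in W) && (e (j./2).*2.+1 \in W).
    apply: (@trig_span_sub _ _ W m (fun k => e k.*2) (fun k => e k.*2.+1) p) => //.
    by move=> s; rewrite -curveE; apply: tW; exists s.
  by move: (odd_double_half j); case: odd => /= jE ? ?; rewrite -jE.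
apply/eqP; rewrite eqEsubv subvf /=; apply/subvP => v _.
rewrite (row_sum_delta v); apply: rpred_sum => j _; apply: rpredZ.
have := eW j; rewrite rpredZeq expf_eq0 (gt_eqF r0) andbF /=.
by congr (_ \in W); apply/rowP => i; rewrite !mxE eqxx.
Qed.

Lemma curve_periodic (t s : R) : curve t (s + 2 * pi) = curve t s.
Proof. by apply/rowP => i; rewrite !mxE trig_periodic. Qed.

Lemma curve_continuous (t : R) : continuous (curve t).
Proof.
move=> s; apply: differentiable_continuous; apply/derivable1_diffP.
by have [] := is_derive_curve t s.
Qed.

End Curve.

Theorem theorem1p1 (R : realType) (m : nat) (hm : (0 < m)%N) :
  exists gamma : R -> R -> 'rV[R]_(2 * m),
    [/\ curve_shortening_flow (@ancient_times R) gamma,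
        compact_connected_flow (@ancient_times R) gamma &
        forall t, t < 0 ->
          forall (p : 'rV[R]_(2 * m)) (W : {vspace 'rV[R]_(2 * m)}),
            \dim W = (2 * m - 1)%N ->
            ~ (range (gamma t) `<=` affine_subspace p W)].
Proof.
exists (curve m); split.
- split; first exact: curve_smooth.
  + by move=> t s t0; exact: curve_immersed.
  + by move=> t s i t0; rewrite derive1_time_curve// laplace_beltrami_curve.
- move=> t _; have pi2 : 0 < 2 * pi :> R by rewrite mulr_gt0// pi_gt0.
  have per := @curve_periodic _ m t.
  split => //; rewrite (periodic_range pi2 per).
    apply: continuous_compact (@segment_compact _ _ _).
    exact/continuous_subspaceT/curve_continuous.
  apply: connected_continuous_connected (@segment_connected _ _ _) _.
  exact/continuous_subspaceT/curve_continuous.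
- move=> t t0 p W dW /(curve_spans hm t0) WE; move: dW.
  rewrite WE dimvf /dim /= mul1n => /eqP.
  (* Positivity of m matters here: the truncated difference 2m - 1 would equal 2m if m were 0. *)
  by rewrite subn1 -[X in X == _]prednK ?muln_gt0// eqn_leq ltnn.
Qed.
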